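(* The real number $T$ (the $y$-coordinate of the vertex $B$) is a root of $$P_T=-492075 + 52356780 T^2 - 1441635408 T^4 + 12222052416 T^6 - 60567699456 T^8 + 189747007488 T^{10} - 417660420096 T^{12} + 607025037312 T^{14} - 655053815808 T^{16} + 446118756352 T^{18} - 422064422912 T^{20} + 437348466688 T^{22},$$ and $P_T$ is its minimal polynomial (it is primitive and irreducible over $\mathbb Z$).
   Context: Consider real numbers $t,T$ and points $A=(0,0)$, $B=(t,T)$, $C=(2t,0)$ and $P=(x_P,y_P)$ for $P\in\{D,E,F,G,H,J\}$ satisfying the system $t^2+T^2=1$; $-t(x_D-2t)+T y_D=\tfrac32$; $(x_D-2t)^2+y_D^2=9$; $t(x_E-t)-T(y_E-T)+1=0$; $(x_E-t)^2+(y_E-T)^2=4$; $x_F^2+y_F^2=1$; $|E-F|^2=1$; $|F-G|^2=1$; $|D-G|^2=4$; $|D-H|^2=4$; $|G-H|^2=4$; $|F-J|^2=1$; $|G-J|^2=1$; $x_H=x_J$. Fix the real solution with $t\approx0.992685948824186$, $T\approx0.120725337054926$, $D\approx(0.809996600722107,\,2.760161754567202)$, $E\approx(0.209102417540010,\,1.960833173433061)$, $F\approx(-0.061398137844065,\,0.998113354619244)$, $G\approx(-0.838419516770942,\,1.627587561152422)$, $H\approx(-0.995049481192288,\,3.621444891616507)$, $J\approx(-0.995049481192288,\,0.639930204451542)$. These points are the essential vertices of one quarter of the Harborth graph (a 4-regular planar unit-distance graph), which is obtained by reflecting in the lines $y=0$ and $x=x_J$. The minimal polynomial of an algebraic number is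 the primitive irreducible integer polynomial of least degree having it as a root. *)

(* Defs.v *)
From mathcomp Require Import all_boot all_order all_algebra reals.

Set Implicit Arguments.
Unset Strict Implicit.
Unset Printing Implicit Defensive.

Import Order.TTheory GRing.Theory Num.Theory.
Local Open Scope ring_scope.

Definition sqdist (R : realType) (p q : R * R) : R :=
  (p.1 - q.1) ^+ 2 + (p.2 - q.2) ^+ 2.

(* Equations for one quarter of the Harborth graph, with A = (0, 0),
   B = (t, T) and C = (2t, 0). *)
Definition harborth_system (R : realType) (t T : R)
    (D E F G H J : R * R) : Prop :=
  let A : R * R := (0, 0) in
  let B : R * R := (t, T) in
  let C : R * R := (2 * t, 0) in
  (t ^+ 2 + T ^+ 2 = 1) /\
  (- t * (D.1 - 2 * t) + T * D.2 = 3 / 2) /\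
  (sqdist D C = 9) /\
  (t * (E.1 - t) - T * (E.2 - T) + 1 = 0) /\
  (sqdist E B = 4) /\
  (sqdist F A = 1) /\
  (sqdist E F = 1) /\
  (sqdist F G = 1) /\
  (sqdist D G = 4) /\
  (sqdist D H = 4) /\
  (sqdist G H = 4) /\
  (sqdist F J = 1) /\
  (sqdist G J = 1) /\
  (H.1 = J.1).

(* The literal n is a natural number, not a numeral of R: ring_scope numerals
   are parsed through unary arithmetic and cannot be this large. *)
Definition dec15 (R : realType) (n : nat) : R := n%:R / 10 ^+ 15.

(* Agreement with a value printed to 15 decimals, up to one unit in the last
   place. *)
Definition approx15 (R : realType) (x d : R) : Prop := `|x - d| < dec15 R 1.

Definition approx15_pt (R : realType) (p d : R * R) : Prop :=
  approx15 p.1 d.1 /\ approx15 p.2 d.2.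

Definition harborth_approx (R : realType) (t T : R)
    (D E F G H J : R * R) : Prop :=
  approx15 t (dec15 R 992685948824186) /\
  approx15 T (dec15 R 120725337054926) /\
  approx15_pt D (dec15 R 809996600722107, dec15 R 2760161754567202) /\
  approx15_pt E (dec15 R 209102417540010, dec15 R 1960833173433061) /\
  approx15_pt F (- dec15 R 61398137844065, dec15 R 998113354619244) /\
  approx15_pt G (- dec15 R 838419516770942, dec15 R 1627587561152422) /\
  approx15_pt H (- dec15 R 995049481192288, dec15 R 3621444891616507) /\
  approx15_pt J (- dec15 R 995049481192288, dec15 R 639930204451542).

Definition P_T : {poly int} :=
  - (492075%:R)%:P
  + 52356780%:R *: 'X^2
  - 1441635408%:R *: 'X^4
  + 12222052416%:R *: 'X^6
  - 60567699456%:R *: 'X^8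
  + 189747007488%:R *: 'X^10
  - 417660420096%:R *: 'X^12
  + 607025037312%:R *: 'X^14
  - 655053815808%:R *: 'X^16
  + 446118756352%:R *: 'X^18
  - 422064422912%:R *: 'X^20
  + 437348466688%:R *: 'X^22.

(* zcontents carries the sign of the leading coefficient, hence the absolute
   value. *)
Definition primitive_int_poly (p : {poly int}) : Prop :=
  `|zcontents p|%N = 1%N.

(* Irreducibility as a ring element. Over int, irreducible_poly would be
   irreducibility over the rationals, because its divisibility is
   pseudo-divisibility. *)
Definition irreducible_elt (A : idomainType) (p : A) : Prop :=
  [/\ p != 0, p \isn't a GRing.unit &
      forall q r : A, p = q * r ->
        (q \is a GRing.unit) \/ (r \is a GRing.unit)].

Definition root_int (R : realType) (p : {poly int}) (x : R) : Prop :=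
  root (map_poly intr p) x.

(* The minimal polynomial is determined only up to sign. *)
Definition is_int_minpoly (R : realType) (p : {poly int}) (x : R) : Prop :=
  [/\ primitive_int_poly p,
      irreducible_elt p,
      root_int p x &
      forall q : {poly int}, q != 0 -> root_int q x -> (size p <= size q)%N].

(* Main.v *)
Require Import Defs.
From mathcomp Require Import all_boot all_order all_algebra all_field reals.
From mathcomp Require Import qpoly qfpoly.
From mathcomp Require Import ring lra zify.

(** [D = C + 3 w] and [E = B + 2 w] for the unit vector w obtained by turning
    [(- t, T)] clockwise by 60 degrees.  As DGH and FGJ are equilateral, the
    condition [H.1 = J.1] fixes the ordinate of [G - F] in terms of
    [K = D - F], and the two circles through G then leave one quartic equation
    on K.  With [S = T / sqrt 3] and all ordinates divided by [sqrt 3],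
    everything is rational: F depends on (t, S) and one square root, and taking
    the norm turns the quartic into a form of degree 16 in (t, S).  It is the
    product of a form with positive coefficients and a form M of degree 11, and
    [P_T (T) = - 3^9 M (t, S) M (t, - S)] on the circle [t^2 + 3 S^2 = 1].

    P_T is primitive and stays irreducible of the same degree modulo 31: a
    proper factor would have a root x in a field with [31^d] elements for some
    [d <= 11], so that [x^(31^d) = x], whereas the product of the
    [X^(31^d) - X] for [1 <= d <= 11] is invertible modulo [(31, P_T)]. *)

Set Implicit Arguments.
Unset Strict Implicit.
Unset Printing Implicit Defensive.

Import Order.TTheory GRing.Theory Num.Theory.
Local Open Scope ring_scope.

(** * Coefficients and values of [P_T] *)

(* Variable coefficients, because simplification must never reach the literals
   of P_T: it would expand them in unary. *)
Definition even_int_poly22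
    (c0 c1 c2 c3 c4 c5 c6 c7 c8 c9 c10 c11 : nat) : {poly int} :=
  - (c0%:R)%:P + c1%:R *: 'X^2 - c2%:R *: 'X^4 + c3%:R *: 'X^6
  - c4%:R *: 'X^8 + c5%:R *: 'X^10 - c6%:R *: 'X^12 + c7%:R *: 'X^14
  - c8%:R *: 'X^16 + c9%:R *: 'X^18 - c10%:R *: 'X^20 + c11%:R *: 'X^22.

Lemma P_T_even_int_poly22 : P_T = even_int_poly22
  492075 52356780 1441635408 12222052416 60567699456 189747007488
  417660420096 607025037312 655053815808 446118756352 422064422912 437348466688.
Proof. reflexivity. Qed.

Lemma even_int_poly22E (c0 c1 c2 c3 c4 c5 c6 c7 c8 c9 c10 c11 : nat) :
  even_int_poly22 c0 c1 c2 c3 c4 c5 c6 c7 c8 c9 c10 c11 =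
  Poly [:: - c0%:R; 0; c1%:R; 0; - c2%:R; 0; c3%:R; 0; - c4%:R; 0; c5%:R; 0;
    - c6%:R; 0; c7%:R; 0; - c8%:R; 0; c9%:R; 0; - c10%:R; 0; c11%:R].
Proof.
apply/polyP => i; rewrite coef_Poly /even_int_poly22.
rewrite !(coefD, coefN, coefC, coefZ, coefXn).
have simp := (mulr1, mulr0, subr0, sub0r, addr0, add0r, oppr0).
by do 23?[case: i => [|i]; first by rewrite /= ?simp]; rewrite /= nth_nil ?simp.
Qed.

Lemma horner_even_int_poly22 (A : comNzRingType) (a : A)
    (c0 c1 c2 c3 c4 c5 c6 c7 c8 c9 c10 c11 : nat) :
  (map_poly intr (even_int_poly22 c0 c1 c2 c3 c4 c5 c6 c7 c8 c9 c10 c11)).[a] =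
  - c0%:R + c1%:R * a ^+ 2 - c2%:R * a ^+ 4 + c3%:R * a ^+ 6
  - c4%:R * a ^+ 8 + c5%:R * a ^+ 10 - c6%:R * a ^+ 12 + c7%:R * a ^+ 14
  - c8%:R * a ^+ 16 + c9%:R * a ^+ 18 - c10%:R * a ^+ 20 + c11%:R * a ^+ 22.
Proof.
rewrite /even_int_poly22 !(rmorphD, rmorphN) /= !map_polyC /= !map_polyZ /=.
rewrite !map_polyXn !(hornerD, hornerN, hornerZ, hornerXn, hornerC).
by rewrite !rmorph_nat.
Qed.

Lemma horner_P_T (A : comNzRingType) (a : A) :
  (map_poly intr P_T).[a] =
  - 492075%:R + 52356780%:R * a ^+ 2 - 1441635408%:R * a ^+ 4
  + 12222052416%:R * a ^+ 6 - 60567699456%:R * a ^+ 8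
  + 189747007488%:R * a ^+ 10 - 417660420096%:R * a ^+ 12
  + 607025037312%:R * a ^+ 14 - 655053815808%:R * a ^+ 16
  + 446118756352%:R * a ^+ 18 - 422064422912%:R * a ^+ 20
  + 437348466688%:R * a ^+ 22.
Proof. exact: horner_even_int_poly22. Qed.

Lemma coef0_P_T : P_T`_0 = - 492075%:R.
Proof. by rewrite P_T_even_int_poly22 even_int_poly22E coef_Poly. Qed.

Lemma coef22_P_T : P_T`_22 = 437348466688%:R.
Proof. by rewrite P_T_even_int_poly22 even_int_poly22E coef_Poly. Qed.

Lemma size_P_T : size P_T = 23.
Proof.
apply/anti_leq/andP; split.
  by rewrite P_T_even_int_poly22 even_int_poly22E (leq_trans (size_Poly _)).
rewrite ltnNge; apply/negP => /leq_sizeP/(_ 22 (leqnn _)).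
rewrite coef22_P_T; lra.
Qed.

(** * T is a root of P_T *)

Section HarborthRoot.
Variable R : realType.
Implicit Types (t T S s u v x k l : R) (P Q V D E F G H J : R * R).

Lemma approx15_bounds x d :
  approx15 x d -> d - 1 / 10 ^+ 15 < x < d + 1 / 10 ^+ 15.
Proof.
rewrite /approx15 /dec15 mulr1n => h.
by have := ltr_distlDr h; have := ltr_distlCBl h => -> ->.
Qed.

(** * Turns by 60 degrees, recovered from dot and cross products *)

Lemma pos_root_unique x y : 0 < x -> 0 < y -> x ^+ 2 = y ^+ 2 -> x = y.
Proof.
by move=> x0 y0 /eqP; rewrite eqrXn2 ?ltW // => /eqP.
Qed.

(** The vector [(u, v)] has length [2 * c] and projection [c] on the unit vector [(- t, T)], so they
    enclose 60 degrees; the sign of the cross product makes the turn clockwise. *)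
Lemma strut_direction s t T u v c :
    s ^+ 2 = 3 -> 0 < s -> 0 < c -> t ^+ 2 + T ^+ 2 = 1 ->
    - t * u + T * v = c -> u ^+ 2 + v ^+ 2 = 4 * c ^+ 2 ->
    0 < t * v + T * u ->
  u = c * (s * T - t) /\ v = c * (T + s * t).
Proof.
move=> s2 s0 c0 tT dot norm cross0.
have cross : t * v + T * u = s * c.
  apply: pos_root_unique => //; first exact: mulr_gt0.
  (* Lagrange's identity: the squared cross product is [4 * c ^+ 2 - c ^+ 2]. *)
  have -> : (t * v + T * u) ^+ 2 =
      (t ^+ 2 + T ^+ 2) * (u ^+ 2 + v ^+ 2) - (- t * u + T * v) ^+ 2 by ring.
  by rewrite tT dot norm exprMn s2; ring.
split.
  rewrite -[LHS]mul1r -tT.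
  have -> : (t ^+ 2 + T ^+ 2) * u =
      - t * (- t * u + T * v) + T * (t * v + T * u) by ring.
  by rewrite dot cross; ring.
rewrite -[LHS]mul1r -tT.
have -> : (t ^+ 2 + T ^+ 2) * v =
    T * (- t * u + T * v) + t * (t * v + T * u) by ring.
by rewrite dot cross; ring.
Qed.

(** Twice the signed area of the triangle QPV, positive when V lies to the left of the ray from Q to
    P. *)
Definition cross (P Q V : R * R) : R :=
  (P.1 - Q.1) * (V.2 - Q.2) - (P.2 - Q.2) * (V.1 - Q.1).

(** [V - Q] is [P - Q] turned counterclockwise by 60 degrees; the abscissa is what [H.1 = J.1]
    compares. *)
Lemma equilateral_apex1 s l P Q V :
    s ^+ 2 = 3 -> 0 < s -> 0 < l ->
    sqdist P Q = l -> sqdist P V = l -> sqdist Q V = l -> 0 < cross P Q V ->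
  V.1 = Q.1 + (P.1 - Q.1 - s * (P.2 - Q.2)) / 2.
Proof.
rewrite /sqdist /cross; case: P Q V => [p1 p2] [q1 q2] [r1 r2] /=.
move=> s2 s0 l0 PQ PV QV cross0.
have dot : (p1 - q1) * (r1 - q1) + (p2 - q2) * (r2 - q2) = l / 2 by lra.
have cr : (p1 - q1) * (r2 - q2) - (p2 - q2) * (r1 - q1) = s * (l / 2).
  apply: pos_root_unique => //; first by apply: mulr_gt0; lra.
  have -> : ((p1 - q1) * (r2 - q2) - (p2 - q2) * (r1 - q1)) ^+ 2 =
     ((p1 - q1) ^+ 2 + (p2 - q2) ^+ 2) * ((q1 - r1) ^+ 2 + (q2 - r2) ^+ 2) -
     ((p1 - q1) * (r1 - q1) + (p2 - q2) * (r2 - q2)) ^+ 2 by ring.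
  by rewrite PQ QV dot [in RHS]exprMn s2; lra.
have l_neq0 : l != 0 by rewrite gt_eqF.
apply: (mulfI l_neq0).
have -> : l * r1 = l * q1 +
    ((p1 - q1) * ((p1 - q1) * (r1 - q1) + (p2 - q2) * (r2 - q2)) -
     (p2 - q2) * ((p1 - q1) * (r2 - q2) - (p2 - q2) * (r1 - q1))).
  by rewrite -PQ; ring.
by rewrite dot cr; lra.
Qed.

Lemma outer_condition s D F G H J :
    s ^+ 2 = 3 -> 0 < s ->
    sqdist F G = 1 -> sqdist D G = 4 -> sqdist D H = 4 -> sqdist G H = 4 ->
    sqdist F J = 1 -> sqdist G J = 1 -> H.1 = J.1 ->
    0 < cross D G H -> 0 < cross G F J ->
    let x := D.1 - F.1 in let k := (D.2 - F.2) / s in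
  4 * x ^+ 4 + 12 * x ^+ 2 * k ^+ 2 - 30 * x ^+ 2 - 18 * x * k + 27 = 0.
Proof.
move=> s2 s0 FG DG DH GH FJ GJ HJ crH crJ x k.
have four0 : (0 : R) < 4 by [].
have H1 := equilateral_apex1 s2 s0 four0 DG DH GH crH.
have GF : sqdist G F = 1 by rewrite -FG /sqdist; ring.
have J1 := equilateral_apex1 s2 s0 ltr01 GF GJ FJ crJ.
have Dx : D.1 = F.1 + x by rewrite /x; ring.
have Dy : D.2 = F.2 + s * k by rewrite /k; field; rewrite gt_eqF.
move: Dx Dy; clearbody x k => Dx Dy.
pose a := G.1 - F.1; pose b := (G.2 - F.2) / s.
have Gx : G.1 = F.1 + a by rewrite /a; ring.
have Gy : G.2 = F.2 + s * b by rewrite /b; field; rewrite gt_eqF.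
move: Gx Gy; clearbody a b => Gx Gy.
move: HJ FG DG; rewrite H1 J1 /sqdist Dx Dy Gx Gy => HJ FG DG.
have sqs z : (s * z) ^+ 2 = 3 * z ^+ 2 by rewrite exprMn s2.
have eb : 6 * b = 3 * k - x.
  have s3 z : s * s * z = 3 * z by rewrite -s2.
  have := s3 k; have := s3 b; lra.
have g1 : a ^+ 2 + 3 * b ^+ 2 = 1 by rewrite -sqs; lra.
have dg : (x - a) ^+ 2 + 3 * (k - b) ^+ 2 = 4 by rewrite -sqs; lra.
have ea : 2 * x * a = x ^+ 2 + x * k - 3.
  have := congr1 (fun z => z * k) eb; lra.
(* The factor [4 * x ^+ 2] lets [a] enter only through [2 * x * a], without a division by x. *)
have : (2 * x * a) ^+ 2 + x ^+ 2 * (6 * b) ^+ 2 / 3 =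
    4 * x ^+ 2 * (a ^+ 2 + 3 * b ^+ 2) by field.
by rewrite g1 ea eb => e; lra.
Qed.

(** * Elimination of F, leading to the form M, here [direction_form] *)

Definition direction_form t S : R :=
  - 5 * t ^+ 11 - 35 * t ^+ 10 * S + 593%:R * t ^+ 9 * S ^+ 2 +
  8375%:R * t ^+ 8 * S ^+ 3 + 50574%:R * t ^+ 7 * S ^+ 4 +
  192738%:R * t ^+ 6 * S ^+ 5 + 541986%:R * t ^+ 5 * S ^+ 6 +
  1225454%:R * t ^+ 4 * S ^+ 7 + 2267879%:R * t ^+ 3 * S ^+ 8 +
  3157585%:R * t ^+ 2 * S ^+ 9 + 2836509%:R * t * S ^+ 10 +
  1105227%:R * S ^+ 11.

(** F is a common point of the unit circles about the origin and E. Taking the norm treats both such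
    points alike, so the sign of the square root never matters. *)
Lemma inner_condition s t S (F : R * R) :
    s ^+ 2 = 3 -> 0 < s -> 0 < t -> 0 < S -> t ^+ 2 + 3 * S ^+ 2 = 1 ->
    let E := (3 * S, s * (2 * S + t)) in
    let D := ((t + 9 * S) / 2, s * (3 * (t + S) / 2)) in
    sqdist F (0, 0) = 1 -> sqdist E F = 1 ->
    let x := D.1 - F.1 in let k := (D.2 - F.2) / s in
    4 * x ^+ 4 + 12 * x ^+ 2 * k ^+ 2 - 30 * x ^+ 2 - 18 * x * k + 27 = 0 ->
  direction_form t S = 0.
Proof.
move=> s2 s0 t0 S0 tS E D FA EF x k Phi0; move: FA EF; rewrite /sqdist /=.
have [phi Fy] : exists phi, F.2 = s * phi.
  by exists (F.2 / s); field; rewrite gt_eqF.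
have sqs z : (s * z) ^+ 2 = 3 * z ^+ 2 by rewrite exprMn s2.
rewrite Fy !subr0 -mulrBr !sqs => FA EF.
(* [3 * e] is the squared length of E. *)
pose e := t ^+ 2 + 4 * t * S + 7 * S ^+ 2.
have e0 : 0 < e by rewrite /e !addr_gt0 ?mulr_gt0 ?exprn_gt0.
have dot : 3 * S * F.1 + 3 * (2 * S + t) * phi = 3 * e / 2 by rewrite /e; lra.
(* F is E / 2 plus a multiple of E turned by a right angle; v is that multiple,
   up to scaling. *)
pose v := 4 * (3 * S * phi - (2 * S + t) * F.1).
have v2 : v ^+ 2 = 4 * e * (t ^+ 2 - 12 * t * S - 9 * S ^+ 2).
  have -> : v ^+ 2 = 16 / 3 * (3 * e * (F.1 ^+ 2 + 3 * phi ^+ 2) -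
     (3 * S * F.1 + 3 * (2 * S + t) * phi) ^+ 2) by rewrite /v /e; field.
  (* The left side is homogeneous: 4 is replaced by [4 * (t ^+ 2 + 3 * S ^+ 2)]. *)
  have -> : t ^+ 2 - 12 * t * S - 9 * S ^+ 2 = 4 - 3 * e by rewrite /e; lra.
  by rewrite FA dot; field.
have fE : F.1 = 3 * S / 2 - v * (2 * S + t) / (4 * e).
  apply: (mulfI (lt0r_neq0 e0)).
  have -> : e * F.1 = (S * (3 * S * F.1 + 3 * (2 * S + t) * phi)
      - (2 * S + t) * v / 4) by rewrite /e /v; field.
  by rewrite dot; field; rewrite gt_eqF.
have phiE : phi = (2 * S + t) / 2 + v * S / (4 * e).
  apply: (mulfI (lt0r_neq0 e0)).
  have -> : e * phi = ((2 * S + t) / 3 * (3 * S * F.1 + 3 * (2 * S + t) * phi)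
      + S * v / 4) by rewrite /e /v; field.
  by rewrite dot; field; rewrite gt_eqF.
have xE : 4 * e * x = 2 * e * (t + 6 * S) + v * (2 * S + t).
  by rewrite /x /D /= fE; field; rewrite gt_eqF.
have kE : 4 * e * k = 2 * e * (2 * t + S) - v * S.
  by rewrite /k /D /= Fy phiE; field; rewrite !gt_eqF.
pose q := t ^+ 2 + 3 * S ^+ 2; pose m := t ^+ 2 - 12 * t * S - 9 * S ^+ 2.
(* [A0 + v * B0] is the reduced quartic up to sign and the factor [256 * e ^+ 2]; [27 * C] is the
   positive cofactor of M in its norm. *)
pose A0 := - 11 * t ^+ 8 - 34 * t ^+ 7 * S + 258%:R * t ^+ 6 * S ^+ 2 +
    2558%:R * t ^+ 5 * S ^+ 3 + 9676%:R * t ^+ 4 * S ^+ 4 +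
    23370%:R * t ^+ 3 * S ^+ 5 + 38766%:R * t ^+ 2 * S ^+ 6 +
    46170%:R * t * S ^+ 7 + 23247%:R * S ^+ 8.
pose B0 := 8 * t ^+ 6 + 69 * t ^+ 5 * S + 237%:R * t ^+ 4 * S ^+ 2 +
    478%:R * t ^+ 3 * S ^+ 3 + 690%:R * t ^+ 2 * S ^+ 4 + 957%:R * t * S ^+ 5 +
    585%:R * S ^+ 6.
pose C := t ^+ 5 + 5 * t ^+ 4 * S + 14 * t ^+ 3 * S ^+ 2 +
    22 * t ^+ 2 * S ^+ 3 + 33 * t * S ^+ 4 + 21 * S ^+ 5.
(* The quartic equation, times [(4 e)^4], reduced modulo [v^2 = 4 e m]; q is 1
   and makes it homogeneous, and c2, c3, c4 are its coefficients in v. *)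
have AB : A0 + v * B0 = 0.
  apply: (mulfI (_ : 256%:R * e ^+ 2 != 0)).
    by rewrite mulf_neq0 ?expf_neq0 ?gt_eqF.
  pose X := 2 * e * (t + 6 * S) + v * (2 * S + t).
  pose K := 2 * e * (2 * t + S) - v * S.
  pose b := 2 * S + t; pose X0 := 2 * e * (t + 6 * S).
  pose K0 := 2 * e * (2 * t + S).
  pose c4 := 4 * b ^+ 2 * (b ^+ 2 + 3 * S ^+ 2).
  pose c3 := 4 * (b ^+ 2 * (2 * X0 * b - 6 * K0 * S) +
                  2 * X0 * b * (b ^+ 2 + 3 * S ^+ 2)).
  pose c2 := 4 * (b ^+ 2 * (X0 ^+ 2 + 3 * K0 ^+ 2) +
      2 * X0 * b * (2 * X0 * b - 6 * K0 * S) +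
      X0 ^+ 2 * (b ^+ 2 + 3 * S ^+ 2)) -
      480%:R * e ^+ 2 * q * b ^+ 2 + 288%:R * e ^+ 2 * q * b * S.
  have -> : 256%:R * e ^+ 2 * (A0 + v * B0) =
      (v ^+ 2 - 4 * e * m) * (c4 * v ^+ 2 + c3 * v + (c2 + 4 * e * m * c4)) -
      (4 * X ^+ 4 + 12 * X ^+ 2 * K ^+ 2 - 480%:R * e ^+ 2 * q * X ^+ 2 -
       288%:R * e ^+ 2 * q * X * K + 27 * 256%:R * e ^+ 4 * q ^+ 2).
    rewrite /A0 /B0 /c4 /c3 /c2 /X /K /b /X0 /K0 /q /m /e; ring.
  rewrite v2 -/m subrr mul0r sub0r mulr0 /q tS /X /K -xE -kE.
  have -> : forall y z, - (4 * (4 * e * y) ^+ 4 +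
      12 * (4 * e * y) ^+ 2 * (4 * e * z) ^+ 2 -
      480%:R * e ^+ 2 * 1 * (4 * e * y) ^+ 2 -
      288%:R * e ^+ 2 * 1 * (4 * e * y) * (4 * e * z) +
      27 * 256%:R * e ^+ 4 * 1 ^+ 2) = - (256%:R * e ^+ 4) *
      (4 * y ^+ 4 + 12 * y ^+ 2 * z ^+ 2 - 30 * y ^+ 2 - 18 * y * z + 27).
    by move=> y z; ring.
  by rewrite Phi0 mulr0.
have C_neq0 : 27 * C != 0.
  by rewrite gt_eqF // mulr_gt0 // /C !addr_gt0 ?mulr_gt0 ?exprn_gt0.
apply: (mulfI C_neq0); rewrite mulr0.
transitivity (A0 ^+ 2 - 4 * e * m * B0 ^+ 2).
  by rewrite /direction_form /A0 /B0 /C /e /m; ring.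
by rewrite -v2 -exprMn subr_sqr AB mulr0.
Qed.

(** Padding by powers of [t ^+ 2 + w], which is 1, gives every term degree 22 in t and T, as a
    factorization into forms requires. *)
Lemma homogenize_even t T w (c0 c1 c2 c3 c4 c5 c6 c7 c8 c9 c10 c11 : R) :
    T ^+ 2 = w -> t ^+ 2 + w = 1 ->
  - c0 + c1 * T ^+ 2 - c2 * T ^+ 4 + c3 * T ^+ 6 - c4 * T ^+ 8
  + c5 * T ^+ 10 - c6 * T ^+ 12 + c7 * T ^+ 14 - c8 * T ^+ 16 + c9 * T ^+ 18
  - c10 * T ^+ 20 + c11 * T ^+ 22 =
  - c0 * (t ^+ 2 + w) ^+ 11 + c1 * w * (t ^+ 2 + w) ^+ 10
  - c2 * w ^+ 2 * (t ^+ 2 + w) ^+ 9 + c3 * w ^+ 3 * (t ^+ 2 + w) ^+ 8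
  - c4 * w ^+ 4 * (t ^+ 2 + w) ^+ 7 + c5 * w ^+ 5 * (t ^+ 2 + w) ^+ 6
  - c6 * w ^+ 6 * (t ^+ 2 + w) ^+ 5 + c7 * w ^+ 7 * (t ^+ 2 + w) ^+ 4
  - c8 * w ^+ 8 * (t ^+ 2 + w) ^+ 3 + c9 * w ^+ 9 * (t ^+ 2 + w) ^+ 2
  - c10 * w ^+ 10 * (t ^+ 2 + w) + c11 * w ^+ 11.
Proof.
by move=> Tw tw; rewrite tw !expr1n !mulr1 -Tw -!exprM.
Qed.

(** M(t, S) M(t, - S) is even in S and of degree 22, so on the circle it is a polynomial in the
    square of [s * S]. *)
Lemma direction_form_root s t S :
    s ^+ 2 = 3 -> t ^+ 2 + 3 * S ^+ 2 = 1 -> direction_form t S = 0 ->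
  root_int P_T (s * S).
Proof.
move=> s2 tS form0; apply/rootP; rewrite horner_P_T.
rewrite (homogenize_even _ _ _ _ _ _ _ _ _ _ _ _ _ tS) ?exprMn ?s2 //.
transitivity (- 19683%:R * direction_form t S * direction_form t (- S)).
  by rewrite /direction_form; ring.
by rewrite form0 mulr0 mul0r.
Qed.

Theorem harborth_root (t T : R) (D E F G H J : R * R) :
    harborth_system t T D E F G H J -> harborth_approx t T D E F G H J ->
  root_int P_T T.
Proof.
case: D E F G H J => [d1 d2] [e1 e2] [f1 f2] [g1 g2] [h1 h2] [j1 j2].
move=> sys.
have pt x y x' y' : approx15_pt (x, y) (x', y') ->
  approx15 x x' /\ approx15 y y' by [].
move=> [t_ [T_ [/pt[Dx Dy] [/pt[Ex Ey] [/pt[Fx Fy] [/pt[Gx Gy]]]]]]].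
move=> [/pt[Hx Hy] /pt[Jx Jy]].
have bounds x lo hi d : lo <= d - 1 / 10 ^+ 15 -> d + 1 / 10 ^+ 15 <= hi ->
    approx15 x d -> lo < x < hi.
  move=> lod dhi /approx15_bounds/andP[dx xd].
  by rewrite (le_lt_trans lod dx) (lt_le_trans xd dhi).
have {}t_ : 99/100 < t < 1 by apply: bounds t_; rewrite /dec15; lra.
have {}T_ : 12/100 < T < 13/100 by apply: bounds T_; rewrite /dec15; lra.
have {}Dx : 8/10 < d1 < 82/100 by apply: bounds Dx; rewrite /dec15; lra.
have {}Dy : 27/10 < d2 < 28/10 by apply: bounds Dy; rewrite /dec15; lra.
have {}Ex : 2/10 < e1 < 21/100 by apply: bounds Ex; rewrite /dec15; lra.
have {}Ey : 19/10 < e2 < 2 by apply: bounds Ey; rewrite /dec15; lra.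
have {}Fx : - (7/100) < f1 < - (6/100).
  by apply: bounds Fx; rewrite /dec15; lra.
have {}Fy : 99/100 < f2 < 1 by apply: bounds Fy; rewrite /dec15; lra.
have {}Gx : - (84/100) < g1 < - (83/100).
  by apply: bounds Gx; rewrite /dec15; lra.
have {}Gy : 162/100 < g2 < 163/100 by apply: bounds Gy; rewrite /dec15; lra.
have {}Hx : -1 < h1 < - (99/100) by apply: bounds Hx; rewrite /dec15; lra.
have {}Hy : 36/10 < h2 < 37/10 by apply: bounds Hy; rewrite /dec15; lra.
have {}Jx : -1 < j1 < - (99/100) by apply: bounds Jx; rewrite /dec15; lra.
have {}Jy : 63/100 < j2 < 64/100 by apply: bounds Jy; rewrite /dec15; lra.
(* The decimals fix four orientations, telling each configuration from its mirror image. *)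
have crH : 0 < cross (d1, d2) (g1, g2) (h1, h2).
  by rewrite /cross /=; nra.
have crJ : 0 < cross (g1, g2) (f1, f2) (j1, j2).
  by rewrite /cross /=; nra.
have crD : 0 < t * d2 + T * (d1 - 2 * t) by nra.
have crE : 0 < t * (e2 - T) + T * (e1 - t) by nra.
have T0 : 0 < T by case/andP: T_ => + _; apply: lt_trans; rewrite divr_gt0.
have t0 : 0 < t by case/andP: t_ => + _; apply: lt_trans; rewrite divr_gt0.
clear t_ T_ Dx Dy Ex Ey Fx Fy Gx Gy Hx Hy Jx Jy.
move: sys.
move=> [tT [D1 [D2 [E1 [E2 [FA [EF [FG [DG [DH [GH [FJ [GJ HJ]]]]]]]]]]]]].
pose s : R := Num.sqrt 3.
have s2 : s ^+ 2 = 3 by rewrite sqr_sqrtr.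
have s0 : 0 < s by rewrite sqrtr_gt0.
have Phi := outer_condition s2 s0 FG DG DH GH FJ GJ HJ crH crJ.
pose S := T / s.
have TE : T = s * S by rewrite /S; field; rewrite gt_eqF.
have S0 : 0 < S by rewrite divr_gt0.
have tS : t ^+ 2 + 3 * S ^+ 2 = 1 by rewrite -s2 -exprMn -TE.
have D2' : (d1 - 2 * t) ^+ 2 + d2 ^+ 2 = 4 * (3 / 2) ^+ 2.
  by move: D2; rewrite /sqdist /= subr0 => ->; field.
have E1' : - t * (e1 - t) + T * (e2 - T) = 1 by move: E1 => /=; lra.
have E2' : (e1 - t) ^+ 2 + (e2 - T) ^+ 2 = 4 * 1 ^+ 2.
  by move: E2; rewrite /sqdist /=; lra.
have c0 : 0 < 3 / 2 :> R by lra.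
have [dx dy] := strut_direction s2 s0 c0 tT D1 D2' crD.
have [ex ey] := strut_direction s2 s0 ltr01 tT E1' E2' crE.
have sS : s * T = 3 * S by rewrite TE mulrA -expr2 s2.
have De : (d1, d2) = ((t + 9 * S) / 2, s * (3 * (t + S) / 2)).
  congr pair; first by move: dx => /=; rewrite sS; lra.
  by move: dy => /=; rewrite TE; lra.
have Ee : (e1, e2) = (3 * S, s * (2 * S + t)).
  congr pair; first by move: ex; rewrite sS; lra.
  by move: ey; rewrite TE; lra.
rewrite TE; apply: (direction_form_root s2 tS).
by apply: (inner_condition s2 s0 t0 S0 tS FA); rewrite -?Ee -?De.
Qed.

End HarborthRoot.

(** * Computing modulo p and a monic polynomial *)

(* A list is the polynomial with these coefficients modulo p, constant term
   first; [xn] is the residue of [X^n]. *)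
Section ModularPolynomials.
Local Open Scope nat_scope.
Variables (p n : nat) (xn : seq nat).
Implicit Types a b h : seq nat.

Fixpoint addm a b : seq nat :=
  match a, b with
  | i :: a', j :: b' => (i + j) %% p :: addm a' b'
  | [::], _ => b
  | _, [::] => a
  end.

Definition scalem c a := [seq (c * i) %% p | i <- a].

(** Only a list of length [n.+1] gets reduced: its last coefficient, that of [X^n], is spread along
    [xn]. *)
Definition mulXm a :=
  let b := 0 :: a in
  if size b == n.+1 then addm (take n b) (scalem (last 0 b) xn) else b.

Fixpoint mulm a b :=
  if a is i :: a' then addm (scalem i b) (mulXm (mulm a' b)) else [::].

Definition frobm a := iter p.-1 (mulm a) a.

(** The list [[:: 0; p.-1]] is [- X] modulo p. *)
Definition frob_diff_step (hw : seq nat * seq nat) :=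
  let h := frobm hw.1 in (h, mulm hw.2 (addm h [:: 0; p.-1])).

(* The pair of [X^(p^d)] and the product of the [X^(p^i) - X], [1 <= i <= d]. *)
Definition frob_diff_prod d := iter d frob_diff_step ([:: 0; 1], [:: 1]).

Local Open Scope ring_scope.
Variables (A : comNzRingType) (x : A).

(** Evaluation at a root of the modulus, in a ring where p vanishes, turns list computations into
    ring identities without building a quotient ring. *)
Definition evalm a : A := foldr (fun c y => c%:R + x * y) 0 a.

Hypotheses (p_gt0 : (0 < p)%N) (p_eq0 : p%:R = 0 :> A).
Hypothesis xnE : x ^+ n = evalm xn.

Lemma natr_modp m : (m %% p)%:R = m%:R :> A.
Proof. by rewrite [in RHS](divn_eq m p) natrD natrM p_eq0 mulr0 add0r. Qed.

Lemma evalm_add a b : evalm (addm a b) = evalm a + evalm b.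
Proof.
elim: a b => [|i a IHa] [|j b] /=; rewrite ?add0r ?addr0 //.
by rewrite IHa natr_modp natrD mulrDr addrACA.
Qed.

Lemma evalm_scale c a : evalm (scalem c a) = c%:R * evalm a.
Proof.
elim: a => [|i a IHa] /=; first by rewrite mulr0.
by rewrite IHa natr_modp natrM mulrDr mulrCA.
Qed.

Lemma evalm_rcons a c : evalm (rcons a c) = evalm a + c%:R * x ^+ size a.
Proof.
elim: a => [|i a IHa] /=; first by rewrite mulr0 addr0 add0r expr0 mulr1.
by rewrite IHa mulrDr addrA exprS mulrCA.
Qed.

Lemma evalm_mulX a : evalm (mulXm a) = x * evalm a.
Proof.
rewrite /mulXm; have <- : evalm (0%N :: a) = x * evalm a by rewrite /= add0r.
case: (lastP (0%N :: a)) => [|b c]; first by case: eqP.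
case: eqP => // sz; move: sz; rewrite size_rcons => -[sz].
by rewrite evalm_add last_rcons evalm_rcons evalm_scale -xnE -sz -cats1
  take_size_cat.
Qed.

Lemma evalm_mul a b : evalm (mulm a b) = evalm a * evalm b.
Proof.
elim: a => [|i a IHa] /=; first by rewrite mul0r.
by rewrite evalm_add evalm_scale evalm_mulX IHa mulrDl mulrA.
Qed.

Lemma evalm_mul_eq0 a b c : mulm a b = c -> evalm b = 0 -> evalm c = 0.
Proof. by move=> <- b0; rewrite evalm_mul b0 mulr0. Qed.

Lemma evalm_frob a : evalm (frobm a) = evalm a ^+ p.
Proof.
rewrite -[in RHS](prednK p_gt0) /frobm.
by elim: p.-1 => [|k IHk]; rewrite ?expr1 // exprS -IHk iterS evalm_mul.
Qed.

Lemma evalm_frob_diff_prod d :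
  evalm (frob_diff_prod d).1 = x ^+ (p ^ d) /\
  evalm (frob_diff_prod d).2 = \prod_(i < d) (x ^+ (p ^ i.+1) - x).
Proof.
rewrite /frob_diff_prod; elim: d => [|d [IHh IHw]].
  by rewrite big_ord0 /= !mulr0 !addr0 add0r mulr1.
rewrite iterS /=; set hw := iter d _ _ in IHh IHw *.
rewrite evalm_frob IHh -exprM -expnSr; split=> //.
rewrite big_ord_recr evalm_mul evalm_add evalm_frob IHh IHw -exprM -expnSr /=.
congr (_ * (_ + _)); rewrite !mulr0 add0r addr0.
apply/eqP; rewrite -subr_eq0 opprK -{2}[x]mulr1 -mulrDr.
by rewrite natr1 prednK // p_eq0 mulr0.
Qed.

End ModularPolynomials.

(** * Roots in finite extensions of a finite field *)

Lemma exists_monic_irreducible_divisor (F : finFieldType) (q : {poly F}) :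
  (1 < size q)%N -> exists2 g, monic_irreducible_poly g & g %| q.
Proof.
have [k] := ubnP (size q); elim: k q => // k IHk q; rewrite ltnS => qk q1.
have [/irreducibleP q_irr|] := boolP (irreducibleb q); last first.
  rewrite /irreducibleb q1 negb_forall => /existsP[r].
  rewrite negb_imply -ltnNge -Pdiv.Idomain.dvdpE => /andP[r_q r1].
  (* [irreducibleb] ranges over polynomials of size at most [(size q).-1], so r is a proper
     divisor. *)
  have rk : (size r < k)%N.
    rewrite (leq_ltn_trans (size_npoly r)) // prednK ?(leq_trans _ qk) //.
    exact: ltnW.
  by have [g g_irr g_r] := IHk _ rk r1; exists g => //; apply: dvdp_trans r_q.
have lq0 : lead_coef q != 0 by rewrite lead_coef_eq0 irredp_neq0.
exists ((lead_coef q)^-1 *: q); last by rewrite dvdpZl ?invr_eq0.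
split; last by rewrite monicE lead_coefZ mulVf.
split=> [|r r1]; first by rewrite size_scale ?invr_eq0.
rewrite dvdpZr ?invr_eq0 // => /(q_irr.2 _ r1)/eqp_trans; apply.
by rewrite eqp_sym eqp_scale ?invr_eq0.
Qed.

(** L is [F[X] / (g)] for an irreducible factor g of q, d is the degree of g, and x is the class of
    X. *)
Lemma root_in_finite_extension (F : finFieldType) (q : {poly F}) :
    (1 < size q)%N ->
  exists (L : finFieldType) (f : {rmorphism F -> L}) (d : nat) (x : L),
    [/\ (0 < d < size q)%N, #|L| = (#|F| ^ d)%N & root (map_poly f q) x].
Proof.
move=> q1; have [g hI g_q] := exists_monic_irreducible_divisor q1.
exists {poly %/ g with hI}, (qpolyC g), (size g).-1, 'qX.
have g1 : (1 < size g)%N by case: hI.1.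
have q0 : q != 0 by rewrite -size_poly_gt0 ltnW.
split; last 1 first.
- have : root (map_poly (qpolyC g) g) 'qX.
    rewrite /root -in_qpoly_comp_horner comp_polyXr.
    apply/eqP/val_inj; rewrite /= /mk_monic g1 hI.2.
    by rewrite Pdiv.RingMonic.rmodpp ?hI.2.
  by have /dvdpP[r ->] := g_q; rewrite rmorphM rootM orbC => ->.
- have := dvdp_leq q0 g_q; case: (size g) g1 => // k k0 kq.
  by rewrite /= -ltnS k0.
- exact: card_qfpoly.
Qed.

(** * Irreducibility of P_T *)

(** The content divides every coefficient, hence also their combination 1. *)
Lemma bezout_coef_primitive (q : {poly int}) (i j : nat) (u v : int) :
  u * q`_i + v * q`_j = 1 -> primitive_int_poly q.
Proof.
move=> bezout; apply/eqP; rewrite -dvdn1 -(dvdzE _ 1) -bezout.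
have := dvdzz (zcontents q); rewrite dvdz_contents => /polyOverP cq.
by rewrite rpredD ?dvdz_mull.
Qed.

Lemma P_T_primitive : primitive_int_poly P_T.
Proof.
(* Bezout cofactors of the constant and leading coefficients, which are coprime. *)
apply: (@bezout_coef_primitive _ 0 22 21443695485%:R 24127%:R).
by rewrite coef0_P_T coef22_P_T; ring.
Qed.

(* [X^22] modulo [(31, P_T)], constant term first. *)
Definition P_T_tail : seq nat :=
  [:: 23; 0; 8; 0; 0; 0; 28; 0; 28; 0; 6; 0; 25; 0; 21; 0; 13; 0; 26; 0; 5;
      0]%N.

(** Inverse, modulo [(31, P_T)], of the product of the [X^(31^i) - X] for i from 1 to 11. *)
Definition P_T_frob_inv : seq nat :=
  [:: 0; 16; 0; 4; 0; 27; 0; 17; 0; 12; 0; 13; 0; 30; 0; 15; 0; 17; 0; 18; 0;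
      22]%N.

Lemma P_T_frob_invE :
  mulm 31 22 P_T_tail P_T_frob_inv (frob_diff_prod 31 22 P_T_tail 11).2 =
  1%N :: nseq 21 0%N.
Proof. vm_compute; reflexivity. Qed.

Lemma P_T_no_small_root (L : finFieldType) (d : nat) (x : L) :
    31%:R = 0 :> L -> (0 < d <= 11)%N -> #|L| = (31 ^ d)%N ->
  (map_poly intr P_T).[x] != 0.
Proof.
move=> p0 d11 cardL; apply/eqP; rewrite horner_P_T => Px.
have xn : x ^+ 22 = evalm x P_T_tail.
  have -> : evalm x P_T_tail =
      23 + 8 * x ^+ 2 + 28 * x ^+ 6 + 28 * x ^+ 8 + 6 * x ^+ 10 +
      25 * x ^+ 12 + 21 * x ^+ 14 + 13 * x ^+ 16 + 26 * x ^+ 18 +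
      5 * x ^+ 20.
    by rewrite /evalm /=; ring.
  (* 20 inverts the leading coefficient of P_T modulo 31, and the polynomial
     below is the quotient by 31 of the difference of the two sides. *)
  apply/eqP; rewrite -subr_eq0 -[0](mulr0 20) -[in X in _ == X]Px.
  rewrite -subr_eq0 -(mul0r (317467%:R - 33778568%:R * x ^+ 2
     + 930087360%:R * x ^+ 4 - 7885195108%:R * x ^+ 6 + 39075935132%:R * x ^+ 8
     - 122417424186%:R * x ^+ 10 + 269458335545%:R * x ^+ 12
     - 391629056331%:R * x ^+ 14 + 422615365037%:R * x ^+ 16
     - 287818552486%:R * x ^+ 18 + 272299627685%:R * x ^+ 20
     - 282160301089%:R * x ^+ 22)) -p0.
  by apply/eqP; ring.
clear Px.
have prod0 : evalm x (frob_diff_prod 31 22 P_T_tail 11).2 = 0.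
  rewrite (evalm_frob_diff_prod (isT : (0 < 31)%N) p0 xn 11).2.
  (* Ordinals start at 0: after this shift, index d carries the exponent [31 ^ d.+1], the cardinal
     of L. *)
  case: d d11 cardL => [//|d] d11 cardL.
  rewrite (bigD1 (Ordinal (d11 : (d < 11)%N))) //= -cardL expf_card.
  by rewrite subrr mul0r.
have : evalm x (1%N :: nseq 21 0%N) = 0.
  exact: (evalm_mul_eq0 p0 xn P_T_frob_invE prod0).
suff -> : evalm x (1%N :: nseq 21 0%N) = 1 by move/eqP; rewrite oner_eq0.
by rewrite /evalm /=; ring.
Qed.

(** As 31 does not divide the leading coefficient, q keeps its degree modulo 31; a nonconstant q
    would then give [P_T] a root in a field too small to contain one. *)
Lemma P_T_factor_size (q r : {poly int}) :
  P_T = q * r -> (size q <= 12)%N -> (size q <= 1)%N.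
Proof.
move=> P_qr q12; rewrite leqNgt; apply/negP => q1.
have F31 : 31%:R = 0 :> 'F_31 by apply: val_inj.
have lead_P : (lead_coef P_T)%:~R != 0 :> 'F_31.
  rewrite lead_coefE size_P_T coef22_P_T rmorph_nat.
  (* The leading coefficient is 14 modulo 31, with quotient 14108015054. *)
  have mod31 (a b : 'F_31) : a = 31%:R * b + 14 -> a != 0.
    by move=> ->; rewrite F31 mul0r add0r.
  by apply: (mod31 _ 14108015054%:R); ring.
have lead_q : (lead_coef q)%:~R != 0 :> 'F_31.
  by move: lead_P; rewrite P_qr lead_coefM intrM mulf_eq0 => /norP[].
have size_q : size (map_poly intr q : {poly 'F_31}) = size q.
  exact: size_map_poly_id0.
have [|L [f [d [x [d_q cardL root_x]]]]] :=
    @root_in_finite_extension _ (map_poly intr q : {poly 'F_31}).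
  by rewrite size_q.
have p0 : 31%:R = 0 :> L by rewrite -(rmorph_nat f) F31 rmorph0.
have d11 : (0 < d <= 11)%N.
  move: d_q; rewrite size_q => /andP[-> dq] /=.
  by rewrite -ltnS (leq_trans dq).
have cardF : #|'F_31| = 31%N := card_Fp (isT : prime 31).
have {}cardL : #|L| = (31 ^ d)%N by rewrite cardL cardF.
have /eqP[] := P_T_no_small_root x p0 d11 cardL.
rewrite P_qr rmorphM hornerM.
suff -> : (map_poly intr q).[x] = 0 by rewrite mul0r.
move/rootP: root_x => <-; congr (_.[x]).
by rewrite -map_poly_comp; apply: eq_map_poly => c /=; rewrite rmorph_int.
Qed.

(** A constant factor divides the content, so it is 1 or -1. *)
Lemma constant_factor_unit (q r : {poly int}) :
  primitive_int_poly (q * r) -> (size q <= 1)%N -> q \is a GRing.unit.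
Proof.
move=> + /size1_polyC q_const; rewrite q_const; move: q`_0 => c.
rewrite /primitive_int_poly mul_polyC zcontentsZ abszM => /eqP.
rewrite muln_eq1 poly_unitE coefC size_polyC /= => /andP[].
by case: c => [[|[|c]]|[|c]].
Qed.

Lemma P_T_irreducible : irreducible_elt P_T.
Proof.
have P0 : P_T != 0 by rewrite -size_poly_gt0 size_P_T.
split=> [//||q r P_qr]; first by rewrite poly_unitE size_P_T.
have [q0 r0] : q != 0 /\ r != 0.
  by apply/andP; rewrite -negb_or -mulf_eq0 -P_qr.
have := size_P_T; rewrite P_qr size_mul // => sizes.
have qr_primitive : primitive_int_poly (q * r).
  by rewrite -P_qr; apply: P_T_primitive.
(* A size is a degree plus one: the degrees add up to 22, so one of them is at most 11. *)
have [q12|q12] := leqP (size q) 12.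
  left; apply: (constant_factor_unit qr_primitive).
  exact: P_T_factor_size P_qr q12.
right; rewrite mulrC in P_qr qr_primitive.
apply: (constant_factor_unit qr_primitive (P_T_factor_size P_qr _)).
by move: sizes q12; move: (size q) (size r) => a b; lia.
Qed.

(** * Minimality of the degree *)

(** The gcd of P and q over the rationals still vanishes at x. By Gauss's lemma it is proportional
    to an integer factor of P; being nonconstant, it has the size of P, and it divides q. *)
Lemma irreducible_root_size (R : realType) (P q : {poly int}) (x : R) :
    irreducible_elt P -> root_int P x -> q != 0 -> root_int q x ->
  (size P <= size q)%N.
Proof.
move=> [_ _ P_irr] Px q0 qx; rewrite leqNgt; apply/negP => qP.
pose toQ := map_poly (intr : int -> rat); pose g := gcdp (toQ P) (toQ q).
have map_toQ (u : {poly int}) :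
    map_poly (ratr : rat -> R) (toQ u) = map_poly intr u.
  by rewrite -map_poly_comp; apply: eq_map_poly => c /=; rewrite ratr_int.
have gx : root (map_poly ratr g) x.
  by rewrite gcdp_map !map_toQ root_gcd; apply/andP.
have [p1 [a a0 g_p1] [r P_p1r]] := dvdpP_rat_int (dvdp_gcdl (toQ P) (toQ q)).
have size_g : size g = size p1.
  by rewrite /g g_p1 size_scale // size_rat_int_poly.
case: (P_irr _ _ P_p1r) => [|].
  rewrite poly_unitE -size_g => /andP[/size_poly1P[c c0 gc] _].
  by move: gx; rewrite gc map_polyC rootC fmorph_eq0 (negPf c0).
rewrite poly_unitE => /andP[/size_poly1P[c c0 rc] _].
move: qP; rewrite P_p1r rc mulrC mul_polyC size_scale // -size_g ltnNge.
rewrite -(size_rat_int_poly q) dvdp_leq ?dvdp_gcdr //.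
by rewrite -size_poly_eq0 size_rat_int_poly size_poly_eq0.
Qed.

Theorem mainTheorem5 (R : realType) (t T : R) (D E F G H J : R * R)
    (Hsys : harborth_system t T D E F G H J)
    (Happrox : harborth_approx t T D E F G H J) :
  root_int P_T T /\ is_int_minpoly P_T T.
Proof.
have PT0 := harborth_root Hsys Happrox.
split=> //; split=> //; [exact: P_T_primitive | exact: P_T_irreducible |].
by move=> q; apply: irreducible_root_size PT0; apply: P_T_irreducible.
Qed.
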